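(* Let $(X,d)$ be a compact metric space, let $\mu_1,\mu_{-1}\in\mathscr{P}(X)$, and for $i=\pm1$ let $l_i:\mathbb{R}\to\mathbb{R}_+$ be convex and let $c_i:X\times X\to\mathbb{R}_+$ be continuous with $c_i(x,x)=0$ for every $x\in X$. Assume that $l_1$ is nonincreasing, $l_{-1}$ is nondecreasing, and $\lim_{t\to-\infty}l_1(t)=\lim_{t\to+\infty}l_{-1}(t)=+\infty$. Assume moreover that at least one of the following holds: - $c_1$ is Lipschitz on $X\times X$, and $l_1$ is either (strictly) decreasing on $\mathbb{R}$ or given by $l_1(t)=\max(0,1-t)$; - $c_{-1}$ is Lipschitz on $X\times X$, and $l_{-1}$ is either (strictly) increasing on $\mathbb{R}$ or given by $l_{-1}(t)=\max(0,1+t)$. Then the minimization problem $$\inf_{h\in C(X)}\ \sum_{i=\pm1}\int_X\max_{z\in X}\{l_i(h(z))-c_i(x,z)\}\,\mathrm{d}\mu_i(x)$$ admits at least one solution $h\in C(X)$ which is Lipschitz on $X$.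
   Context: $\mathbb{R}_+=[0,+\infty)$; $\mathscr{P}(X)$ is the set of Borel probability measures on $X$ and $C(X)$ the set of continuous real-valued functions on $X$. Lipschitz on $X\times X$ is understood with respect to the product distance $d(x,x')+d(z,z')$. *)

(* Defs.v *)
From HB Require Import structures.
From mathcomp Require Import all_boot all_order all_algebra.
From mathcomp Require Import all_classical all_reals all_analysis.

Set Implicit Arguments.
Unset Strict Implicit.
Unset Printing Implicit Defensive.

Import Order.TTheory GRing.Theory Num.Theory.
Import numFieldNormedType.Exports.

Local Open Scope classical_set_scope.
Local Open Scope ring_scope.

(* The library only generates sigma-algebras on pointed types. The base point
   costs no generality here: a space carrying a probability measure is
   nonempty. *)
#[short(type="pmetricType")]
HB.structure Definition PointedMetric (K : numDomainType) :=
  {T of Metric K T & isPointed T}.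

Definition borel (T : ptopologicalType) := g_sigma_algebraType (@open T).

(* The library's [lipschitz] is restricted to normed modules. *)
Definition lipschitz_wrt (R : realType) (T : Type) (dist : T -> T -> R)
    (f : T -> R) : Prop :=
  exists2 L : R, 0 <= L & forall x y, `|f x - f y| <= L * dist x y.

Definition sum_dist (R : realType) (X : metricType R) (p q : X * X) : R :=
  mdist p.1 q.1 + mdist p.2 q.2.

(* max_z (l (h z) - c (x, z)); the supremum is attained, see
   [adversarial_loss_max]. *)
Definition adversarial_loss (R : realType) (X : Type) (l : R -> R)
    (c : X * X -> R) (h : X -> R) (x : X) : R :=
  sup [set l (h z) - c (x, z) | z in [set: X]].

Lemma adversarial_loss_max (R : realType) (X : ptopologicalType) (l : R -> R)
    (c : X * X -> R) (h : X -> R) (x : X) :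
  compact [set: X] -> continuous l -> continuous c -> continuous h ->
  exists2 z, adversarial_loss l c h x = l (h z) - c (x, z) &
    forall y, l (h y) - c (x, y) <= l (h z) - c (x, z).
Proof.
move=> cX cl cc ch.
have cf : continuous (fun z => l (h z) - c (x, z)).
  move=> z; apply: cvgB.
    by apply: (@continuous_comp _ _ _ h l); [exact: ch|exact: cl].
  apply: (@continuous_comp _ _ _ (pair x) c); last exact: cc.
  by apply: cvg_pair => //=; exact: cvg_cst.
have [z _ zmax] := @compact_EVT_max X R _ setT
  (ex_intro _ point I) cX (continuous_subspaceT cf).
have {}zmax y : l (h y) - c (x, y) <= l (h z) - c (x, z).
  by apply: zmax; rewrite inE.
exists z => //; rewrite /adversarial_loss; apply/eqP; rewrite eq_le.
apply/andP; split.
  by apply: ge_sup; [exists (l (h z) - c (x, z)), z|move=> _ [y _ <-]].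
by apply: ub_le_sup; [exists (l (h z) - c (x, z)) => _ [y _ <-]|exists z].
Qed.

(* The integrand is nonnegative when l is and c vanishes on the diagonal, and
   it is bounded and continuous for continuous h, so no convention for the
   integral of a non-integrable function is involved. *)
Definition adversarial_risk (R : realType) (X : pmetricType R)
    (mu1 mum1 : probability (borel X) R) (l1 lm1 : R -> R)
    (c1 cm1 : X * X -> R) (h : X -> R) : \bar R :=
  (\int[mu1]_x (adversarial_loss l1 c1 h x)%:E +
   \int[mum1]_x (adversarial_loss lm1 cm1 h x)%:E)%E.

(* Main.v *)
Require Import Defs.
From HB Require Import structures.
From mathcomp Require Import all_boot all_order all_algebra.
From mathcomp Require Import all_classical all_reals all_analysis.
From mathcomp Require Import measurable_realfun ring lra.

Set Implicit Arguments.
Unset Strict Implicit.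
Unset Printing Implicit Defensive.

Import Order.TTheory GRing.Theory Num.Theory.
Import numFieldNormedType.Exports.

Local Open Scope classical_set_scope.
Local Open Scope ring_scope.

(** The infimum is attained by the direct method: it suffices to minimize over a
    set of uniformly bounded, uniformly Lipschitz functions, which is compact
    for uniform convergence, and the risk is continuous there.

    The bound on [h] comes for free from the adversary. Since a cost [c] is
    bounded on the compact [X * X], the loss at every [x] is at least
    [l (h z) - max c] for every [z], whatever the measures are; so a bound on
    the risk bounds [l1 (h z)] and [lm1 (h z)] uniformly in [z], and the limits
    of [l1] at [-oo] and of [lm1] at [+oo] bound [h z] on both sides
    ([adversarial_risk_bounded_sublevel]).

    For the Lipschitz bound, suppose that [c1] is [L]-Lipschitz and that [l1]
    decreases with slope at least [kappa] on the half-line left of [T].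
    Truncating [h] at [T] and replacing it by the inf-convolution
    [g z = min_w (min (h w) T + (L / kappa) * mdist w z)] gives an
    [L / kappa]-Lipschitz function below [h]. The term of [lm1] decreases by
    monotonicity. The term of [l1] does not increase: if [w] attains the
    minimum at [z], passing from [min (h w) T] to [g z] lowers [l1] by at least
    [L * mdist w z], which is at least what the adversary may save in cost by
    aiming at [z] instead of [w] ([steep_lipschitz_regularization]). The two
    alternatives allowed for [l1] are exactly what provides [T] and [kappa]
    once [h] is bounded ([steep]): a strictly decreasing convex function has a
    slope bounded away from zero on every left half-line, and the hinge loss
    has slope [-1] left of [T = 1] and is constant afterwards.

    The assumption on [cm1] and [lm1] is reduced to the one on [c1] and [l1]
    by changing [h] into [- h] and exchanging the two classes
    ([adversarial_risk_opp]). *)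

(** * Convex functions of one real variable *)

Lemma convex_chord (R : realType) (l : R -> R) (a b c : R) :
  @convex_function R R^o setT l -> a < b -> b < c ->
  (c - a) * l b <= (c - b) * l a + (b - a) * l c.
Proof.
move=> cl ab bc.
have ac0 : 0 < c - a by lra.
have t01 : 0 <= (c - b) / (c - a) <= 1.
  by rewrite divr_ge0 ?ler_pdivrMr//=; lra.
have /andP[t0 t1] := t01.
have w1 : 1 - (c - b) / (c - a) = (b - a) / (c - a) by field; lra.
have bE : conv (Itv01 t0 t1) (a : R^o) c = b.
  by rewrite convRE/= /unstable.onem w1; field; lra.
have := cl (Itv01 t0 t1) a c; rewrite !inE => /(_ I I).
rewrite [X in l X](bE : _ = b) convRE/= /unstable.onem w1.
rewrite -(ler_pM2l ac0) => /le_trans; apply.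
by rewrite le_eqVlt; apply/orP; left; apply/eqP; field; lra.
Qed.

(** The slopes of a convex function on [[-M, M]] lie between those of the chords
    to [-M - 1] and to [M + 1]; these have length at least [1], and by
    nonnegativity their rises are controlled by the two outer values. *)
Lemma convex_lipschitz_itv (R : realType) (l : R -> R) (M : R) :
  @convex_function R R^o setT l -> (forall t, 0 <= l t) ->
  exists2 K, 0 <= K & forall s t, `|s| <= M -> `|t| <= M ->
    l s <= l t + K * `|s - t|.
Proof.
move=> cl l0; exists (l (M + 1) + l (- M - 1)) => [|s t].
  by have := l0 (M + 1); have := l0 (- M - 1); lra.
rewrite !ler_norml => /andP[s1 s2] /andP[t1 t2].
have l1 := l0 (M + 1); have l2 := l0 (- M - 1).
have ls := l0 s; have lt := l0 t.
have [st|ts|->] := ltgtP s t; last by rewrite subrr normr0 mulr0 addr0.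
- rewrite distrC gtr0_norm ?subr_gt0//.
  have C := @convex_chord _ _ (- M - 1) s t cl ltac:(lra) st.
  have pt : 0 <= (t - s) * l t by rewrite mulr_ge0//; lra.
  have pM : 0 <= (t - s) * l (M + 1) by rewrite mulr_ge0//; lra.
  have [|lts] := leP (l s) (l t); last have : 0 <= (l s - l t) * (t + M); nra.
- rewrite gtr0_norm ?subr_gt0//.
  have C := @convex_chord _ _ t s (M + 1) cl ts ltac:(lra).
  have pt : 0 <= (s - t) * l t by rewrite mulr_ge0//; lra.
  have pM : 0 <= (s - t) * l (- M - 1) by rewrite mulr_ge0//; lra.
  have [|lts] := leP (l s) (l t); last have : 0 <= (l s - l t) * (M - t); nra.
Qed.

(** What makes [steep_lipschitz_regularization] apply to every function bounded
    by [M]. The threshold [T] may differ from [M] because a loss may become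
    constant, as the hinge loss does from [1] on. *)
Definition steep (R : realType) (l : R -> R) := forall M, exists T kappa,
  [/\ 0 < kappa, forall s t, s <= t -> t <= T -> l t + kappa * (t - s) <= l s &
      forall t, t <= M -> l (Num.min t T) = l t].

(** By convexity the slope of [l] left of [M] is at most its slope on
    [[M, M + 1]], which is negative when [l] is strictly decreasing. *)
Lemma convex_decreasing_steep (R : realType) (l : R -> R) :
  @convex_function R R^o setT l -> {homo l : s t / s < t >-> t < s} -> steep l.
Proof.
move=> cl dl M; exists M, (l M - l (M + 1)); split.
- by rewrite subr_gt0 dl// ltrDl.
- move=> s t; rewrite le_eqVlt => /predU1P[->|st tM].
    by rewrite subrr mulr0 addr0.
  have tM1 : t < M + 1 by lra.
  have C1 := convex_chord cl st tM1.
  have C2 : (M + 1 - t) * (l M - l (M + 1)) <= l t - l (M + 1).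
    have [tM'|Mt] := ltP t M.
      by have := @convex_chord _ _ t M (M + 1) cl tM' ltac:(lra); nra.
    have -> : t = M by apply/eqP; rewrite eq_le tM Mt.
    by rewrite addrAC subrr add0r mul1r.
  have {}C1 : (t - s) * (l t - l (M + 1)) <= (M + 1 - t) * (l s - l t) by nra.
  rewrite -lerBrDl -(@ler_pM2l _ (M + 1 - t)) ?subr_gt0//.
  apply: le_trans C1; rewrite mulrA mulrC.
  by rewrite ler_pM2l ?subr_gt0.
- by move=> t tM; rewrite min_l.
Qed.

Lemma hinge_steep (R : realType) (l : R -> R) :
  (forall t, l t = Num.max 0 (1 - t)) -> steep l.
Proof.
move=> lE M; exists 1, 1; split => // [s t st t1|t _]; rewrite !lE.
  by rewrite !max_r; lra.
by have [t1|t1] := leP t 1; rewrite ?subrr ?maxxx// max_l//; lra.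
Qed.

(** * Adversarial losses of continuous functions *)

Lemma lipschitz_wrt_continuous (R : realType) (X : metricType R) (f : X -> R) :
  lipschitz_wrt (@mdist R X) f -> continuous f.
Proof.
move=> [L L0 Lf] x; apply/cvgrPdist_le => e e0.
have d0 : 0 < e / (L + 1) by rewrite divr_gt0// ltr_wpDl.
apply/metricType_numDomainType.nbhs_mdistP.
exists (e / (L + 1)) => // y /= /ltW xy.
apply: (le_trans (Lf x y)).
have : L * mdist x y <= (L + 1) * (e / (L + 1)).
  by rewrite ler_pM ?mdist_ge0 ?lerDl.
by rewrite [X in _ <= X]mulrC divfK// gt_eqF// ltr_wpDl.
Qed.

Lemma mdist_lipschitz (R : realType) (X : metricType R) (w x y : X) :
  `|mdist w x - mdist w y| <= mdist x y.
Proof.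
rewrite ler_norml; apply/andP; split.
  by have := metric_triangle w x y; lra.
by have := metric_triangle w y x; rewrite (metric_sym y x); lra.
Qed.

Lemma continuous_compact_ub (R : realType) (X : topologicalType) (x0 : X)
    (f : X -> R) :
  compact [set: X] -> continuous f -> exists B, forall x, f x <= B.
Proof.
move=> cX cf.
have [m _ fm] := @compact_EVT_max X R f setT (ex_intro _ x0 I) cX
  (continuous_subspaceT cf).
by exists (f m) => x; apply: fm; rewrite inE.
Qed.

Definition convex_loss (R : realType) (l : R -> R) :=
  (forall t, 0 <= l t) /\ @convex_function R R^o setT l.

Definition transport_cost (R : realType) (X : ptopologicalType)
    (c : X * X -> R) :=
  [/\ forall p, 0 <= c p, continuous c & forall x, c (x, x) = 0].

Lemma loss_comp_ub (R : realType) (X : ptopologicalType) (l : R -> R)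
    (h : X -> R) :
  compact [set: X] -> convex_loss l -> continuous h ->
  exists B, forall z, l (h z) <= B.
Proof.
move=> cX [l0 cl] ch.
have cnh : continuous (fun x => `|h x|).
  by move=> x; apply: cvg_norm; exact: ch.
have [M hM] := continuous_compact_ub point cX cnh.
have M0 : 0 <= M by rewrite (le_trans _ (hM point)).
have [K K0 lK] := convex_lipschitz_itv M cl l0.
exists (l 0 + K * M) => z; have := lK (h z) 0 (hM z); rewrite normr0 subr0.
move=> /(_ M0)/le_trans; apply; rewrite lerD2l; exact: ler_wpM2l.
Qed.

Section adversarial_loss_theory.
Context (R : realType) (X : ptopologicalType) (l : R -> R) (c : X * X -> R).
Context (cX : compact [set: X]) (Hl : convex_loss l) (Hc : transport_cost c).

Lemma adversarial_loss_ge (h : X -> R) (x z : X) : continuous h ->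
  l (h z) - c (x, z) <= adversarial_loss l c h x.
Proof.
move=> ch; have [B lB] := loss_comp_ub cX Hl ch; have [c0 _ _] := Hc.
apply: ub_le_sup; last by exists z.
by exists B => _ [y _ <-]; rewrite lerBlDr (le_trans (lB y))// lerDl.
Qed.

Lemma adversarial_loss_le (h : X -> R) (x : X) (b : R) :
  (forall z, l (h z) - c (x, z) <= b) -> adversarial_loss l c h x <= b.
Proof.
move=> hb; apply: ge_sup => [|_ [z _ <-]//].
by exists (l (h point) - c (x, point)), point.
Qed.

Lemma adversarial_loss_ge0 (h : X -> R) (x : X) : continuous h ->
  0 <= adversarial_loss l c h x.
Proof.
move=> ch; apply: le_trans (@adversarial_loss_ge h x x ch).
by have [_ _ ->] := Hc; rewrite subr0; have [] := Hl.
Qed.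

(** A supremum of functions continuous in [x] is lower semicontinuous: its
    strict superlevel sets are unions of open sets. *)
Lemma measurable_adversarial_loss (h : X -> R) : continuous h ->
  measurable_fun [set: borel X] (adversarial_loss l c h : borel X -> R).
Proof.
move=> ch mT; apply: (measurability _ (RGenOInfty.measurableE R)) => //.
move=> _ [_ [r ->] <-]; rewrite setTI; apply: sub_sigma_algebra.
rewrite (_ : _ @^-1` _ =
  \bigcup_(z in [set: X]) [set x | r < l (h z) - c (x, z)]).
  apply: bigcup_open => z _.
  have cz : continuous (fun x => l (h z) - c (x, z)).
    move=> x; apply: cvgB; first exact: cvg_cst.
    apply: (@continuous_comp _ _ _ (fun x => (x, z)) c).
      by apply: cvg_pair => //=; exact: cvg_cst.
    by have [_ + _] := Hc; exact.
  rewrite -[X in open X]/((fun x => l (h z) - c (x, z)) @^-1`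
    [set y : R | r < y]).
  by apply: open_comp; [move=> x _; exact: cz|exact: open_gt].
apply/seteqP; split => x /=; rewrite in_itv/= andbT.
  move=> /sup_gt[|_ [z _ <-] rz]; last by exists z.
  by exists (l (h point) - c (x, point)), point.
by move=> [z _ rz]; exact: lt_le_trans rz (adversarial_loss_ge _ _ ch).
Qed.

End adversarial_loss_theory.

(** * Integrated adversarial losses *)

Section integral_bounds.
Context (R : realType) (X : ptopologicalType) (mu : probability (borel X) R).
Context (l : R -> R) (c : X * X -> R).
Context (cX : compact [set: X]) (Hl : convex_loss l) (Hc : transport_cost c).
Local Notation loss h := (EFin \o (adversarial_loss l c h : borel X -> R)).

Let measurable_loss (h : X -> R) : continuous h ->
  measurable_fun [set: borel X] (loss h).
Proof.
by move=> ch; apply/measurable_EFinP; exact: measurable_adversarial_loss.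
Qed.

Let loss_ge0 (h : X -> R) : continuous h ->
  forall x, [set: borel X] x -> (0 <= loss h x)%E.
Proof. by move=> ch x _; rewrite lee_fin; exact: adversarial_loss_ge0. Qed.

Lemma integral_adversarial_loss_ge0 (h : X -> R) : continuous h ->
  (0 <= \int[mu]_x (adversarial_loss l c h x)%:E)%E.
Proof. by move=> ch; exact: integral_ge0 (loss_ge0 ch). Qed.

Lemma integral_adversarial_loss_leD (h g : X -> R) (e : R) :
  continuous h -> continuous g -> 0 <= e ->
  (forall x, adversarial_loss l c h x <= adversarial_loss l c g x + e) ->
  (\int[mu]_x (adversarial_loss l c h x)%:E <=
   \int[mu]_x (adversarial_loss l c g x)%:E + e%:E)%E.
Proof.
move=> ch cg e0 hg.
rewrite -[e%:E]mule1 -(@probability_setT _ _ _ mu) -integral_cst//=.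
rewrite -ge0_integralD//; last 2 first.
- exact: loss_ge0.
- exact: measurable_loss.
apply: ge0_le_integral => //.
- exact: loss_ge0.
- exact: measurable_loss.
- by apply: emeasurable_funD => //; exact: measurable_loss.
- by move=> x _; rewrite -EFinD lee_fin.
Qed.

Lemma integral_adversarial_loss_le (h : X -> R) (b : R) : continuous h ->
  (forall x, adversarial_loss l c h x <= b) ->
  (\int[mu]_x (adversarial_loss l c h x)%:E <= b%:E)%E.
Proof.
move=> ch hb; rewrite -[b%:E]mule1 -(@probability_setT _ _ _ mu).
rewrite -integral_cst//; apply: ge0_le_integral => //.
- exact: loss_ge0.
- exact: measurable_loss.
- by move=> x _; rewrite lee_fin.
Qed.

Lemma integral_adversarial_loss_ge (h : X -> R) (b : R) : continuous h ->
  (forall x, b <= adversarial_loss l c h x) ->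
  (b%:E <= \int[mu]_x (adversarial_loss l c h x)%:E)%E.
Proof.
move=> ch hb; have [b0|/ltW b0] := leP 0 b; last first.
  by apply: (le_trans _ (integral_adversarial_loss_ge0 ch)); rewrite lee_fin.
rewrite -[b%:E]mule1 -(@probability_setT _ _ _ mu).
rewrite -integral_cst//; apply: ge0_le_integral => //.
- exact: measurable_loss.
- by move=> x _; rewrite lee_fin.
Qed.

(** The adversary can move any point to any [z] at a cost of at most
    [B = max c], so one large value of [l \o h] is felt by the whole space. *)
Lemma integral_adversarial_loss_ge_loss :
  exists B, forall h z, continuous h ->
    ((l (h z) - B)%:E <= \int[mu]_x (adversarial_loss l c h x)%:E)%E.
Proof.
have [_ cc _] := Hc.
have cXX : compact [set: X * X] by rewrite -setXTT; exact: compact_setX.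
have [B cB] := continuous_compact_ub (point, point) cXX cc.
exists B => h z ch; apply: integral_adversarial_loss_ge => // x.
apply: le_trans (adversarial_loss_ge cX Hl Hc x z ch).
by rewrite lerB.
Qed.

End integral_bounds.

(** * Compactness of bounded Lipschitz functions *)

Definition bounded_lipschitz (R : realType) (X : metricType R) (M L : R)
    (h : X -> R) :=
  (forall x, `|h x| <= M) /\ forall x y, `|h x - h y| <= L * mdist x y.

Section compactness.
(* The topology of pointwise convergence on functions. *)
Import ArrowAsProduct.

(** An Arzela-Ascoli argument. The sublevel sets of [J], being nested, generate
    a filter; Tychonoff's theorem gives it a pointwise limit point [h], which is
    again bounded and Lipschitz. Equicontinuity and compactness of [X] turn
    pointwise into uniform closeness, so functions of each sublevel set come
    uniformly close to [h], and the semicontinuity of [J] concludes. *)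
Lemma bounded_lipschitz_minimizer (R : realType) (X : pmetricType R) (M L : R)
    (J : (X -> R) -> \bar R) (h0 : X -> R) :
  compact [set: X] -> 0 <= L -> bounded_lipschitz M L h0 ->
  (forall e, 0 < e -> exists2 d, 0 < d & forall h g,
    bounded_lipschitz M L h -> bounded_lipschitz M L g ->
    (forall x, `|h x - g x| <= d) -> (J h <= J g + e%:E)%E) ->
  exists2 h, bounded_lipschitz M L h &
    forall g, bounded_lipschitz M L g -> (J h <= J g)%E.
Proof.
move=> cX L0 Kh0 Jlsc.
pose K := [set h : X -> R | bounded_lipschitz M L h].
pose S g := [set h : X -> R | K h /\ (J h <= J g)%E].
pose F := filter_from K S.
have FF : ProperFilter F.
  apply: filter_from_proper; last by move=> g Kg; exists g.
  apply: filter_from_filter; first by exists h0.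
  move=> f g Kf Kg; have [fg|gf] := leP (J f) (J g).
    by exists f => // h [Kh hf]; do !split=> //; exact: le_trans fg.
  by exists g => // h [Kh hg]; do !split=> //; apply: le_trans (ltW gf).
pose box := [set f : X -> R | forall x, `[- M, M]%classic (f x)].
have cbox : compact box.
  exact: (@tychonoff X (fun=> R) (fun=> `[- M, M]%classic)
    (fun=> @segment_compact _ _ _)).
have Fbox : F box.
  exists h0 => // h [[hM _] _] x /=.
  by rewrite in_itv/= -ler_norml.
have [h [boxh]] := cbox _ _ Fbox.
rewrite cluster_cvgE => -[G PG [Gh FG]].
(* [G] is finer than the filter of sublevel sets and converges to [h]. *)
have Gpt x e : 0 < e -> \forall k \near G, `|h x - k x| < e.
  move=> e0; have Gx : (fun k : X -> R => k x) @ G --> h x.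
    apply: (cvg_trans (cvg_app (@proj X (fun=> R) x) Gh)).
    exact: proj_continuous.
  by move/cvgrPdist_lt : Gx; apply.
have GK : G K by apply: FG; exists h0 => // k [].
have Kh : K h.
  split=> [x|x y]; first by have := boxh x; rewrite /= in_itv/= ler_norml.
  apply/ler_addgt0Pr => e e0.
  have e20 : 0 < e / 2 by rewrite divr_gt0.
  have [k [[[_ kL] kx] ky]] :=
    filter_ex (filterI (filterI GK (Gpt x _ e20)) (Gpt y _ e20)).
  have -> : h x - h y = (h x - k x) + (k x - k y) - (h y - k y) by ring.
  rewrite (le_trans (ler_normB _ _))//.
  have := ler_normD (h x - k x) (k x - k y).
  by have := kL x y; move: kx ky => /= ; lra.
exists h => // g Kg; apply/lee_addgt0Pr => e /Jlsc[d d0 Jd].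
(* If [k] is [d / 2]-close to [h] at [x], it is [d]-close on the ball around [x]
   where [h] and [k] vary by at most [d / 4] each; [L + 1] guards against
   [L = 0]. *)
have Gunif : \forall k \near G,
    [set: X] `<=` [set x | K k -> `|h x - k x| <= d].
  move/compact_near_coveringP : cX; apply => x _.
  have r0 : 0 < d / (4 * (L + 1)) by rewrite divr_gt0// mulr_gt0// ltr_wpDl.
  have d20 : 0 < d / 2 by rewrite divr_gt0.
  exists ([set y | mdist x y < d / (4 * (L + 1))],
          [set k | `|h x - k x| < d / 2]).
    split; last exact: Gpt.
    by apply/metricType_numDomainType.nbhs_mdistP; exists (d / (4 * (L + 1))).
  move=> [y k] [/= xy hk] [_ kL].
  have -> : h y - k y = (h x - k x) - (h x - h y) + (k x - k y) by ring.
  rewrite (le_trans (ler_normD _ _))//.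
  have := ler_normB (h x - k x) (h x - h y).
  have Lxy : L * mdist x y <= d / 4.
    have : L * mdist x y <= (L + 1) * (d / (4 * (L + 1))).
      by rewrite ler_pM ?mdist_ge0 ?lerDl// ltW.
    suff -> : (L + 1) * (d / (4 * (L + 1))) = d / 4 by [].
    by field; rewrite gt_eqF// ltr_wpDl.
  have := kL x y; have := Kh.2 x y; lra.
have GS : G (S g) by apply: FG; exists g.
have [k [[Kk kg] hk]] := filter_ex (filterI GS Gunif).
apply: (le_trans (Jd h k Kh Kk (fun x => hk x I Kk))).
by rewrite leeD2r.
Qed.

End compactness.

(** * Lipschitz regularization *)

(** Inf-convolution of the truncation [min h T] with the cone
    [(L / kappa) * mdist]. The slope [L / kappa] is the one for which the
    decrease of [l] between [min (h w) T] and [g z], where [w] attains the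
    infimum at [z], pays for the variation of the cost between [(x, w)] and
    [(x, z)]. *)
Lemma steep_lipschitz_regularization (R : realType) (X : pmetricType R)
    (l : R -> R) (c : X * X -> R) (L T kappa : R) (h : X -> R) :
  compact [set: X] -> convex_loss l -> transport_cost c ->
  (forall p q, `|c p - c q| <= L * sum_dist p q) ->
  0 <= L -> 0 < kappa ->
  (forall s t, s <= t -> t <= T -> l t + kappa * (t - s) <= l s) ->
  continuous h -> (forall z, l (Num.min (h z) T) = l (h z)) ->
  exists g : X -> R,
    [/\ forall x y, `|g x - g y| <= L / kappa * mdist x y,
        forall z, g z <= h z &
        forall x, adversarial_loss l c g x <= adversarial_loss l c h x].
Proof.
move=> cX Hl Hc cL L0 k0 lk ch hT.
pose h' z := Num.min (h z) T.
have ch' : continuous h'.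
  by move=> z; apply: continuous_min; [exact: ch|exact: cvg_cst].
have Lk0 : 0 <= L / kappa by rewrite divr_ge0// ltW.
have argmin z : exists w, forall y,
    h' w + L / kappa * mdist w z <= h' y + L / kappa * mdist y z.
  have cd : continuous (fun w => mdist w z).
    apply: lipschitz_wrt_continuous; exists 1 => // x y; rewrite mul1r.
    by rewrite !(metric_sym _ z) mdist_lipschitz.
  have cm : continuous (fun w => h' w + L / kappa * mdist w z).
    move=> w; apply: cvgD; first exact: ch'.
    by apply: cvgM; [exact: cvg_cst|exact: cd].
  have [w _ wm] := @compact_EVT_min X R _ setT (ex_intro _ point I) cX
    (continuous_subspaceT cm).
  by exists w => y; apply: wm; rewrite inE.
have [w wmin] := choice argmin.
pose g z := h' (w z) + L / kappa * mdist (w z) z.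
have gh z : g z <= h' z.
  by have := wmin z z; rewrite mdistxx mulr0 addr0.
have gL x y : g x - g y <= L / kappa * mdist x y.
  have := wmin x (w y).
  have : L / kappa * mdist (w y) x <= L / kappa * (mdist (w y) y + mdist y x).
    by rewrite ler_wpM2l// metric_triangle.
  rewrite (metric_sym y x) mulrDr /g; lra.
exists g; split.
- move=> x y; rewrite ler_norml gL andbT.
  by have := gL y x; rewrite (metric_sym y x); lra.
- by move=> z; rewrite (le_trans (gh z))// ge_min lexx.
move=> x; apply: adversarial_loss_le => z.
apply: le_trans (adversarial_loss_ge cX Hl Hc x (w z) ch).
have sg : h' (w z) <= g z by rewrite lerDl mulr_ge0// mdist_ge0.
have gT : g z <= T by rewrite (le_trans (gh z))// ge_min lexx orbT.
(* The slope of [l] between [h' (w z)] and [g z] makes up exactly for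
   [L * mdist (w z) z]. *)
have := lk _ _ sg gT; rewrite hT.
have -> : kappa * (g z - h' (w z)) = L * mdist (w z) z.
  by rewrite /g; field; rewrite gt_eqF.
have := cL (x, w z) (x, z); rewrite /sum_dist/= mdistxx add0r ler_norml.
by move=> /andP[]; lra.
Qed.

(** * Existence of a Lipschitz minimizer *)

Section minimization.
Context (R : realType) (X : pmetricType R) (mu1 mum1 : probability (borel X) R).
Context (l1 lm1 : R -> R) (c1 cm1 : X * X -> R).
Context (cX : compact [set: X]) (Hl1 : convex_loss l1) (Hlm1 : convex_loss lm1).
Context (Hc1 : transport_cost c1) (Hcm1 : transport_cost cm1).
Local Notation risk := (adversarial_risk mu1 mum1 l1 lm1 c1 cm1).

Lemma adversarial_risk_bounded_sublevel (b : R) :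
  l1 t @[t --> -oo] --> +oo -> lm1 t @[t --> +oo] --> +oo ->
  exists M, forall h, continuous h -> (risk h <= b%:E)%E ->
    forall z, `|h z| <= M.
Proof.
move=> l1y lm1y.
have [B1 hB1] := integral_adversarial_loss_ge_loss mu1 cX Hl1 Hc1.
have [Bm1 hBm1] := integral_adversarial_loss_ge_loss mum1 cX Hlm1 Hcm1.
have [A1 [_ hA1]] := cvgry_gt l1y (b + B1).
have [Am1 [_ hAm1]] := cvgry_gt lm1y (b + Bm1).
exists (`|A1| + `|Am1|) => h ch hb z.
have i1 := integral_adversarial_loss_ge0 mu1 cX Hl1 Hc1 ch.
have im1 := integral_adversarial_loss_ge0 mum1 cX Hlm1 Hcm1 ch.
have h1 : A1 <= h z.
  rewrite leNgt; apply/negP => /hA1; apply/negP; rewrite -leNgt -lerBlDr.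
  by rewrite -lee_fin (le_trans (hB1 h z ch))// (le_trans _ hb)// leeDl.
have hm1 : h z <= Am1.
  rewrite leNgt; apply/negP => /hAm1; apply/negP; rewrite -leNgt -lerBlDr.
  by rewrite -lee_fin (le_trans (hBm1 h z ch))// (le_trans _ hb)// leeDr.
rewrite ler_norml; have := ler_norm Am1; have := ler_norm (- A1).
rewrite normrN; have := normr_ge0 A1; have := normr_ge0 Am1.
by move=> *; apply/andP; split; lra.
Qed.

(** Both losses are Lipschitz on [[-M, M]], with constants [K1] and [Km1], and a
    supremum changes by no more than the functions under it. *)
Lemma adversarial_risk_uniform_lsc (M L e : R) : 0 <= L -> 0 < e ->
  exists2 d, 0 < d & forall h g : X -> R,
    bounded_lipschitz M L h -> bounded_lipschitz M L g ->
    (forall x, `|h x - g x| <= d) -> (risk h <= risk g + e%:E)%E.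
Proof.
move=> L0 e0.
have [K1 K10 lip1] := convex_lipschitz_itv M Hl1.2 Hl1.1.
have [Km1 Km10 lipm1] := convex_lipschitz_itv M Hlm1.2 Hlm1.1.
have K0 : 0 < K1 + Km1 + 1 by lra.
exists (e / (K1 + Km1 + 1)); first exact: divr_gt0.
set d := e / _ => h g [hM hL] [gM gL] hg.
have d0 : 0 < d by exact: divr_gt0.
have ch : continuous h by apply: lipschitz_wrt_continuous; exists L.
have cg : continuous g by apply: lipschitz_wrt_continuous; exists L.
have loss_leD l c K : convex_loss l -> transport_cost c -> 0 <= K ->
    (forall s t, `|s| <= M -> `|t| <= M -> l s <= l t + K * `|s - t|) ->
    forall x, adversarial_loss l c h x <= adversarial_loss l c g x + K * d.
  move=> Hl Hc Kge0 lK x; apply: adversarial_loss_le => z.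
  have := adversarial_loss_ge cX Hl Hc x z cg.
  have := lK _ _ (hM z) (gM z).
  by have : K * `|h z - g z| <= K * d by [rewrite ler_wpM2l]; lra.
have i1 := integral_adversarial_loss_leD mu1 cX Hl1 Hc1 ch cg
  (mulr_ge0 K10 (ltW d0)) (loss_leD _ _ _ Hl1 Hc1 K10 lip1).
have im1 := integral_adversarial_loss_leD mum1 cX Hlm1 Hcm1 ch cg
  (mulr_ge0 Km10 (ltW d0)) (loss_leD _ _ _ Hlm1 Hcm1 Km10 lipm1).
apply: (le_trans (leeD i1 im1)); rewrite addeACA leeD2l// -EFinD lee_fin.
rewrite -mulrDl (@le_trans _ _ ((K1 + Km1 + 1) * d))//.
  by rewrite ler_pM2r// lerDl.
by rewrite /d mulrC divfK// gt_eqF.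
Qed.

Lemma lipschitz_minimizer :
  {homo lm1 : s t / s <= t} -> steep l1 -> lipschitz_wrt (@sum_dist R X) c1 ->
  l1 t @[t --> -oo] --> +oo -> lm1 t @[t --> +oo] --> +oo ->
  exists h : X -> R,
    [/\ continuous h, lipschitz_wrt (@mdist R X) h &
        forall g : X -> R, continuous g -> (risk h <= risk g)%E].
Proof.
move=> lm1_homo l1_steep [L L0 c1L] l1y lm1y.
(* The level [b] is that of the constant [0], so that the sublevel set to which
   the a priori bound [M] applies is not empty. *)
pose b := l1 0 + lm1 0.
pose h0 (_ : X) : R := 0.
have c0 : continuous h0 by move=> ?; exact: cvg_cst.
have risk0 : (risk h0 <= b%:E)%E.
  rewrite EFinD leeD// integral_adversarial_loss_le// => x;
    apply: adversarial_loss_le => z; rewrite gerBl.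
  - by have [] := Hc1.
  - by have [] := Hcm1.
have [M hM] := adversarial_risk_bounded_sublevel b l1y lm1y.
have [T [k [k0 lk lT]]] := l1_steep M.
have Lk0 : 0 <= L / k by rewrite divr_ge0// ltW.
have K0 : bounded_lipschitz M (L / k) h0.
  split=> [x|x y]; first exact: hM c0 risk0 x.
  by rewrite subrr normr0 mulr_ge0// mdist_ge0.
have [h [h_M hL] hmin] := bounded_lipschitz_minimizer cX Lk0 K0
  (fun e => @adversarial_risk_uniform_lsc M (L / k) e Lk0).
have hlip : lipschitz_wrt (@mdist R X) h by exists (L / k).
exists h; split => //; first exact: lipschitz_wrt_continuous.
move=> g cg; have [gb|/ltW gb] := leP (risk g) b%:E; last first.
  exact: le_trans (hmin _ K0) (le_trans risk0 gb).
have [g' [g'L g'g g'loss]] := steep_lipschitz_regularization cX Hl1 Hc1 c1L L0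
  k0 lk cg (fun z => lT _ (le_trans (ler_norm _) (hM g cg gb z))).
have cg' : continuous g' by apply: lipschitz_wrt_continuous; exists (L / k).
have g'risk : (risk g' <= risk g)%E.
  have i1 : (\int[mu1]_x (adversarial_loss l1 c1 g' x)%:E <=
             \int[mu1]_x (adversarial_loss l1 c1 g x)%:E)%E.
    rewrite -[leRHS]adde0; apply: integral_adversarial_loss_leD => // x.
    by rewrite addr0.
  apply: leeD => //; rewrite -[leRHS]adde0.
  apply: integral_adversarial_loss_leD => // x; rewrite addr0.
  apply: adversarial_loss_le => z.
  apply: le_trans (adversarial_loss_ge cX Hlm1 Hcm1 x z cg).
  by rewrite lerB// lm1_homo.
apply: (le_trans _ g'risk); apply: hmin; split => //.
exact: hM cg' (le_trans g'risk gb).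
Qed.

End minimization.

Lemma convex_loss_opp (R : realType) (l : R -> R) :
  convex_loss l -> convex_loss (fun t => l (- t)).
Proof.
move=> [l0 cl]; split=> // t x y _ _.
have := cl t (- x) (- y); rewrite !inE => /(_ I I).
by rewrite -[X in l X <= _](convN (x : R^o) y t).
Qed.

Lemma adversarial_risk_opp (R : realType) (X : pmetricType R)
    (mu1 mum1 : probability (borel X) R) (l1 lm1 : R -> R)
    (c1 cm1 : X * X -> R) (h : X -> R) :
  adversarial_risk mum1 mu1 (fun t => lm1 (- t)) (fun t => l1 (- t)) cm1 c1
    (fun x => - h x) = adversarial_risk mu1 mum1 l1 lm1 c1 cm1 h.
Proof.
rewrite /adversarial_risk addeC /adversarial_loss.
by congr (_ + _)%E; apply: eq_integral => x _; under eq_fun do rewrite opprK.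
Qed.

Theorem proposition4p4 (R : realType) (X : pmetricType R)
  (mu1 mum1 : probability (borel X) R)
  (l1 lm1 : R -> R) (c1 cm1 : X * X -> R) :
  compact [set: X] ->
  (forall t, 0 <= l1 t) -> (forall t, 0 <= lm1 t) ->
  @convex_function R R^o setT l1 -> @convex_function R R^o setT lm1 ->
  (forall p, 0 <= c1 p) -> (forall p, 0 <= cm1 p) ->
  continuous c1 -> continuous cm1 ->
  (forall x, c1 (x, x) = 0) -> (forall x, cm1 (x, x) = 0) ->
  {homo l1 : s t / s <= t >-> t <= s} ->
  {homo lm1 : s t / s <= t} ->
  l1 t @[t --> -oo] --> +oo ->
  lm1 t @[t --> +oo] --> +oo ->
  (lipschitz_wrt (@sum_dist R X) c1 /\
     ({homo l1 : s t / s < t >-> t < s} \/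
      forall t, l1 t = Num.max 0 (1 - t))) \/
  (lipschitz_wrt (@sum_dist R X) cm1 /\
     ({homo lm1 : s t / s < t} \/
      forall t, lm1 t = Num.max 0 (1 + t))) ->
  exists h : X -> R,
    [/\ continuous h, lipschitz_wrt (@mdist R X) h &
        forall g : X -> R, continuous g ->
          (adversarial_risk mu1 mum1 l1 lm1 c1 cm1 h <=
           adversarial_risk mu1 mum1 l1 lm1 c1 cm1 g)%E].
Proof.
move=> cX l10 lm10 cl1 clm1 c10 cm10 cc1 ccm1 c1d cm1d l1h lm1h l1y lm1y.
have Hl1 : convex_loss l1 by [].
have Hlm1 : convex_loss lm1 by [].
have Hc1 : transport_cost c1 by [].
have Hcm1 : transport_cost cm1 by [].
case=> [[c1L l1s]|[cm1L lm1s]].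
  apply: lipschitz_minimizer => //.
  by case: l1s; [exact: convex_decreasing_steep|exact: hinge_steep].
have Hl1' := convex_loss_opp Hl1; have Hlm1' := convex_loss_opp Hlm1.
have lm1h' : {homo (fun t => l1 (- t)) : s t / s <= t}.
  by move=> s t st; rewrite l1h// lerN2.
have lm1_steep : steep (fun t => lm1 (- t)).
  case: lm1s => [lm1_incr|lm1E].
    apply: convex_decreasing_steep => [|s t st]; first exact: Hlm1'.2.
    by rewrite lm1_incr// ltrN2.
  by apply: hinge_steep => t; rewrite lm1E.
have lm1y' : lm1 (- t) @[t --> -oo] --> +oo.
  by have /cvgy_compNP := lm1y.
have l1y' : l1 (- t) @[t --> +oo] --> +oo.
  by have /cvgNy_compNP := l1y.
have [h [ch [L L0 hL] hmin]] := lipschitz_minimizer mum1 mu1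
  cX Hlm1' Hl1' Hcm1 Hc1 lm1h' lm1_steep cm1L lm1y' l1y'.
exists (fun x => - h x); split.
- by move=> x; apply: cvgN; exact: ch.
- by exists L => // x y; rewrite -opprD normrN.
move=> g cg; have riskN := adversarial_risk_opp mu1 mum1 l1 lm1 c1 cm1.
rewrite -(riskN (fun x => - h x)) -(riskN g).
have -> : (fun x => - - h x) = h by apply/funext => x; rewrite opprK.
by apply: hmin => x; apply: cvgN; exact: cg.
Qed.
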